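(* Let $n\ge 1$ and $G=S_n$, and consider the symmetric group algebra over the rationals, $\mathbb{Q}[S_n]$. For each partition $\lambda$ of $n$, let $\rho_\lambda:G\to GL(d_\lambda,\mathbb{Q})$ be a matrix form of the irreducible (Specht) representation of $G$ labeled by $\lambda$, of dimension $d_\lambda$. Let $$P_\lambda=\frac1{|G|}\sum_{g\in G}\rho_\lambda(g)\rho_\lambda(g)^{*},$$ a positive symmetric matrix, diagonalized as $P_\lambda=M_\lambda D_\lambda M_\lambda^{-1}$ with $D_\lambda$ diagonal with entries $d_{\lambda,1},\dots,d_{\lambda,d_\lambda}$. Let $Q_\lambda=M_\lambda D_\lambda^{1/2}M_\lambda^{-1}$ be the principal square root of $P_\lambda$, and put $\tau_\lambda(g)=Q_\lambda^{-1}\rho_\lambda(g)Q_\lambda$ for $g\in G$. Consider the discrete Fourier transform $$f\longmapsto \bigl(\hat f(\tau_\lambda)\bigr)_{\lambda\vdash n},\qquad \hat f(\tau_\lambda)=\sum_{g\in G}\sqrt{\frac{d_\lambda}{|G|}}\,f(g)\,\tau_\lambda(g).$$ The only square roots appearing in it are those in the unitary factors $\sqrt{d_\lambda/|G|}$ and in the matrices $D_\lambda^{1/2}$. Thus one can form, by successive quadratic extensions starting from $\mathbb{Q}$, the field $$K=\mathbb{Q}\bigl(\sqrt{d_\lambda},\ \sqrt{|G|},\ \sqrt{d_{\lambda,i}}\ :\ \lambda\vdash n,\ 1\le i\le d_\lambda\bigr)\subset\mathbb{C}.$$ The field $K$ is a finite degree extension of $\mathbb{Q}$, so a number field; each $\tau_\lambda:G\to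 GL(d_\lambda,K)$ is a unitary representation defined over $K$; and the overall discrete Fourier transform is unitary.
   Context: $M^{*}$ denotes the conjugate transpose of a matrix $M$ (for real matrices, the transpose). A representation $\tau$ is unitary if $\tau(g)\tau(g)^{*}=I$ for all $g\in G$. The matrix of the discrete Fourier transform is the $|G|\times|G|$ matrix whose columns are indexed by $g\in G$, whose rows are indexed by triples $(\lambda,i,j)$ with $\lambda\vdash n$ and $1\le i,j\le d_\lambda$, and whose entries are $\sqrt{d_\lambda/|G|}\,\tau_\lambda(g)_{ij}$; the transform is unitary if this matrix $U$ satisfies $UU^{*}=I$. The square roots are the positive ones, and $D_\lambda^{1/2}$ is the diagonal matrix with entries $\sqrt{d_{\lambda,i}}$. Over fields of characteristic $0$, the Specht representations labeled by the partitions of $n$ are irreducible and form a complete set of irreducible representations of $S_n$.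
   Formalization: K need not arise by successive quadratic extensions from Q, since the d_{λ,i} can have degree 3 over Q (n=4, λ=(3,1), a suitable rational basis); here the successive square roots start from Q(d_{λ,i}), which is Q when all d_{λ,i} are rational. *)

(* Defs.v *)
From HB Require Import structures.
From mathcomp Require Import all_boot all_order all_algebra all_fingroup.
From mathcomp Require Import all_field all_character.
From mathcomp Require Import spectral classical_sets reals complex.

Set Implicit Arguments.
Unset Strict Implicit.
Unset Printing Implicit Defensive.

Import Order.TTheory GRing.Theory Num.Theory.
Local Open Scope ring_scope.
Local Open Scope sesquilinear_scope.

(* A partition of n is stored as lam_0 >= ... >= lam_(n-1) >= 0, padded with
   zeros to length n, so that intpart n is a finite type. *)
Definition is_intpart n (t : n.-tuple 'I_n.+1) :=
  sorted geq (map val t) && (sumn (map val t) == n).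

Definition intpart n := {t : n.-tuple 'I_n.+1 | is_intpart t}.

HB.instance Definition _ n := Finite.on (intpart n).

Section Specht.
Variable n : nat.

(* A tableau is given by the map sending each entry to its cell (row, column).
   The diagram of lam has exactly n cells, so an injective map from the n
   entries into the diagram is a bijective filling. *)
Definition is_tableau (lam : intpart n) (t : {ffun 'I_n -> 'I_n * 'I_n}) :=
  injectiveb t && [forall x, (t x).2 < tnth (val lam) (t x).1]%N.

(* A tabloid (a tableau up to permutations preserving its rows) is determined
   by the row in which each entry lies. *)
Definition tabloid := {ffun 'I_n -> 'I_n}.

Definition tabloid_of (t : {ffun 'I_n -> 'I_n * 'I_n}) : tabloid :=
  [ffun x => (t x).1].

(* The entry x of T becomes the entry s x. As (s * u) x = u (s x) in 'S_n,
   this is a right action. *)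
Definition tabloid_act (T : tabloid) (s : 'S_n) : tabloid :=
  [ffun x => T (s^-1%g x)].

(* Formal rational combinations of tabloids of all shapes; the span of the
   tabloids of shape lam is the permutation module M^lam. *)
Definition tabloid_space := {ffun tabloid -> rat^o}.

(* Linear extension of tabloid_act: the coefficient of T in v.s is that of
   T.s^-1 in v. *)
Definition space_act (v : tabloid_space) (s : 'S_n) : tabloid_space :=
  [ffun T => v (tabloid_act T s^-1%g)].

Definition col_stab (t : {ffun 'I_n -> 'I_n * 'I_n}) : {set 'S_n} :=
  [set s : 'S_n | [forall x, (t (s x)).2 == (t x).2]].

Definition polytabloid (t : {ffun 'I_n -> 'I_n * 'I_n}) : tabloid_space :=
  [ffun T => \sum_(s in col_stab t)
     (-1) ^+ odd_perm s * (T == tabloid_act (tabloid_of t) s)%:R].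

Definition specht (lam : intpart n) : {vspace tabloid_space} :=
  <<[seq polytabloid t | t <- enum (is_tableau lam)]>>%VS.

(* rG is the matrix form, in some rational basis, of the Specht module of lam.
   Representations act on row vectors: row i of rG s holds the coordinates
   of e_i.s. *)
Definition specht_form (lam : intpart n) (d : nat)
    (rG : mx_representation rat [set: 'S_n]%G d) : Prop :=
  exists e : d.-tuple tabloid_space,
    basis_of (specht lam) e /\
    forall (s : 'S_n) (i : 'I_d),
      space_act e`_i s = \sum_(j < d) rG s i j *: e`_j.

End Specht.

Section Unitarization.
Variables (gT : finGroupType) (d : nat).

Definition average_form (rG : mx_representation rat [set: gT]%G d) : 'M[rat]_d :=
  #|gT|%:R^-1 *: \sum_(g : gT) rG g *m (rG g)^T.

Variable C : numClosedFieldType.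

(* sqrtC x is the nonnegative square root when x is a nonnegative real. *)
Definition diag_sqrt (M : 'M[C]_d) (D : 'rV[C]_d) : 'M[C]_d :=
  M *m diag_mx (\row_i sqrtC (D 0 i)) *m invmx M.

Definition conj_repr (rG : mx_representation rat [set: gT]%G d)
    (Q : 'M[C]_d) (g : gT) : 'M[C]_d :=
  invmx Q *m map_mx ratr (rG g) *m Q.

End Unitarization.

Section Fourier.
Variables (C : numClosedFieldType) (gT I : finType) (d : I -> nat).
Variable tau : forall l : I, gT -> 'M[C]_(d l).

Definition fourier_scale (l : I) : C := sqrtC ((d l)%:R / #|gT|%:R).

Definition fourier (f : gT -> C) (l : I) : 'M[C]_(d l) :=
  \sum_(g : gT) (fourier_scale l * f g) *: tau l g.

Definition fourier_index := {l : I & ('I_(d l) * 'I_(d l))%type}.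

HB.instance Definition _ := Finite.on fourier_index.

(* Rows and columns are numbered by the enumerations of the triples (l, i, j)
   and of the group. *)
Definition fourier_mx : 'M[C]_(#|{: fourier_index}|, #|{: gT}|) :=
  \matrix_(r, c)
    let x := enum_val r in
    fourier_scale (tag x) *
      tau (tag x) (enum_val c) (tagged x).1 (tagged x).2.

Lemma fourier_mxE (f : gT -> C) (x : fourier_index) :
  \sum_c fourier_mx (enum_rank x) c * f (enum_val c) =
  fourier f (tag x) (tagged x).1 (tagged x).2.
Proof.
rewrite /fourier summxE (reindex _ (onW_bij _ (@enum_val_bij gT))) /=.
by apply: eq_bigr => c _; rewrite !mxE enum_rankK mulrAC.
Qed.

End Fourier.

Section Subfields.
Local Open Scope classical_set_scope.
Variable C : numClosedFieldType.

Definition subfield (K : set C) : Prop :=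
  [/\ K 1, forall x y, K x -> K y -> K (x - y)
         & forall x y, K x -> K y -> K (x / y)].

(* Every subfield contains the rationals, so this is Q(S). *)
Definition adjoin (S : set C) : set C := smallest subfield S.

Definition number_field (K : set C) : Prop :=
  exists (L : fieldExtType rat) (iota : {rmorphism L -> C}), K = range iota.

Inductive quadratic_tower (F : set C) : set C -> Prop :=
| quadratic_tower0 : quadratic_tower F F
| quadratic_towerS (K : set C) (x : C) :
    quadratic_tower F K -> K (x ^+ 2) ->
    quadratic_tower F (adjoin (K `|` [set x])).

Variables (I : Type) (d : I -> nat) (D : forall l : I, 'rV[C]_(d l)).

(* The entries of D are real algebraic numbers of possibly odd degree, so a
   tower of quadratic steps to sqrt_field has to start here; when they are
   rational this is the field of rationals. *)
Definition eigenvalue_field : set C :=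
  adjoin [set x | exists l i, x = D l 0 i].

Definition sqrt_field (N : nat) : set C :=
  adjoin ([set x | exists l, x = sqrtC (d l)%:R] `|` [set sqrtC N%:R] `|`
          [set x | exists l i, x = sqrtC (D l 0 i)]).

End Subfields.

(* Main.v *)
Require Import Defs.
From HB Require Import structures.
From mathcomp Require Import all_boot all_order all_algebra all_fingroup.
From mathcomp Require Import all_field all_character.
From mathcomp Require Import spectral classical_sets reals complex.
From mathcomp Require Import boolp all_solvable.

Set Implicit Arguments.
Unset Strict Implicit.
Unset Printing Implicit Defensive.

Import Order.TTheory GRing.Theory Num.Theory.
Local Open Scope ring_scope.
Local Open Scope sesquilinear_scope.

(** Two independent facts carry the theorem.

    Unitarization.  The form [P] is invariant, [rho(h) P rho(h)^T = P], and
    positive definite, so its eigenvalues are positive reals.  Its square root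
    [Q] is Hermitian although [M] need not be unitary, because eigenspaces of
    [P] for distinct eigenvalues are orthogonal ([diag_sqrt_hermitian]).  Then
    [tau(g) tau(g)^* = Q^-1 rho(g) P rho(g)^T Q^-1 = Q^-1 P Q^-1 = 1].
    Interpolating the square root at the eigenvalues writes [Q] as a polynomial
    in the rational matrix [P] with coefficients in [K], so the entries of
    [tau(g)] lie in [K] ([conj_repr_field]).  The eigenvalues are algebraic and
    [K] is obtained from the field they generate by adjoining square roots one
    at a time, hence is a number field.

    Unitarity of the transform.  Its rows are orthonormal by Schur's relations,
    which only need that an intertwiner from [tau_lam] to [tau_mu] vanishes for
    [lam <> mu] and is a scalar for [lam = mu].  Both follow from James's
    argument: an intertwiner sends the polytabloid of a tableau [t] to a vector
    on which the column group of [t] acts by the sign character.  If such a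
    vector, supported on tabloids of shape [mu], is nonzero, then [lam]
    dominates [mu] ([specht_intertwiner_dominates]); if it has shape [lam], it
    is a multiple of the polytabloid itself ([specht_intertwiner_scalar]).  As
    the adjoint of an intertwiner of unitary representations is an intertwiner
    in the opposite direction, dominance holds both ways and forces
    [lam = mu].

    The matrix is square because the Specht modules exhaust the irreducible
    representations: they are irreducible and pairwise non-isomorphic, and
    permutations with the same cycle type are conjugate, so there are at most as
    many classes, that is, irreducible representations, as partitions.  The sum
    of the squares of the degrees is therefore the order of the group. *)

(** * Number fields and quadratic towers *)

Section FieldClosure.
Local Open Scope classical_set_scope.
Variable C : numClosedFieldType.
Implicit Types (S K : set C) (x : C) (s : seq C).

Lemma adjoin_subfield S : subfield (adjoin S).
Proof.
split=> [K [[K1 _ _] _] //|x y Sx Sy K KS|x y Sx Sy K KS].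
  by case: (KS) => [[_ KB _] _]; apply: KB; [apply: Sx|apply: Sy].
by case: (KS) => [[_ _ KD] _]; apply: KD; [apply: Sx|apply: Sy].
Qed.

Lemma sub_adjoin S : S `<=` adjoin S. Proof. exact: sub_gen_smallest. Qed.

Lemma adjoin_min S K : subfield K -> S `<=` K -> adjoin S `<=` K.
Proof. exact: smallest_sub. Qed.

Lemma subfieldM K x y : subfield K -> K x -> K y -> K (x * y).
Proof.
by move=> [K1 _ KD] Kx Ky; rewrite -[y]invrK; apply/KD=> //; rewrite -div1r; apply: KD.
Qed.

Lemma range_subfield (L : fieldType) (iota : {rmorphism L -> C}) :
  subfield (range iota).
Proof.
split=> [|_ _ [x _ <-] [y _ <-]|_ _ [x _ <-] [y _ <-]].
- by exists 1; rewrite ?rmorph1.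
- by exists (x - y); rewrite ?rmorphB.
- by exists (x / y); rewrite ?fmorph_div.
Qed.

Lemma subfield_horner (L : fieldType) (iota : {rmorphism L -> C}) K x
    (p : {poly L}) :
  subfield K -> range iota `<=` K -> K x -> K (map_poly iota p).[x].
Proof.
move=> sK iK Kx; have [K1 KB KD] := sK.
elim/poly_ind: p => [|p c IH].
  by rewrite rmorph0 horner0 -(subrr 1); apply: KB.
rewrite rmorphD rmorphM /= map_polyX map_polyC !hornerE.
rewrite -[X in K (_ + X)]opprK; apply: KB; first exact: subfieldM.
by rewrite -rmorphN; apply: iK; exists (- c).
Qed.

(** If [x] is a root of a nonzero polynomial over a number field [L], a root
    polynomial of least degree is irreducible, and the quotient of [L[X]] by it
    is a finite extension of [L], hence of the rationals, with image [L(x)]. *)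
Lemma number_field_adjoin (L : fieldExtType rat) (iota : {rmorphism L -> C}) x
    (p : {poly L}) :
  p != 0 -> root (map_poly iota p) x ->
  number_field (adjoin (range iota `|` [set x])).
Proof.
move=> p0 px.
have [q [q0 qx minq]] : exists q : {poly L}, [/\ q != 0, root (map_poly iota q) x
    & forall r, root (map_poly iota r) x -> r != 0 -> (size q <= size r)%N].
  have [m] := ubnP (size p); elim: m p p0 px => // m IH p p0 px sp.
  have [[r [rx r0 sr]]|H] := pselect (exists r : {poly L},
     [/\ root (map_poly iota r) x, r != 0 & (size r < size p)%N]).
    by apply: (IH r) => //; apply: leq_trans sr _.
  exists p; split=> // r rx r0; rewrite leqNgt; apply/negP => sr; apply: H.
  by exists r.
have irr : irreducible_poly q by apply/(subfx_irreducibleP qx q0).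
pose L1 := SubFieldExtType qx irr.
pose j : {rmorphism L1 -> C} := @subfx_inj _ _ iota x q.
exists (baseFieldType L1), (j : {rmorphism baseFieldType L1 -> C}).
apply/seteqP; split.
  apply: adjoin_min; first exact: range_subfield.
  move=> _ [[y _ <-]|->].
    by exists (y%:A : L1) => //; rewrite /j /= subfx_inj_base.
  by exists (subfx_root iota x q : L1) => //; rewrite /j /= subfx_inj_root.
move=> _ [y _ <-]; have [r ->] := subfxEroot qx q0 y.
have -> : j (map_poly (in_alg (subFExtend iota x q)) r).[subfx_root iota x q] =
          (map_poly iota r).[x].
  rewrite -horner_map /= subfx_inj_root // -map_poly_comp.
  by congr (_.[x]); apply: eq_map_poly => c /=; rewrite subfx_inj_base.
apply: (subfield_horner (K := adjoin _)); first exact: adjoin_subfield.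
- by move=> z Kz; apply: sub_adjoin; left.
- by apply: sub_adjoin; right.
Qed.

Lemma adjoin_id K : subfield K -> adjoin K = K.
Proof. by move=> sK; apply/seteqP; split; [apply: adjoin_min|apply: sub_adjoin]. Qed.

Lemma adjoinS S T : S `<=` T -> adjoin S `<=` adjoin T.
Proof.
move=> ST; apply: adjoin_min; first exact: adjoin_subfield.
by apply: subset_trans ST _; apply: sub_adjoin.
Qed.

Lemma adjoinU S x : adjoin (adjoin S `|` [set x]) = adjoin (S `|` [set x]).
Proof.
apply/seteqP; split.
  apply: adjoin_min; first exact: adjoin_subfield.
  move=> y [|->]; first by apply: adjoinS => z; left.
  by apply: sub_adjoin; right.
by apply: adjoinS => y [Sy|->]; [left; apply: sub_adjoin|right].
Qed.

Definition algebraic_over_rat x := exists2 p : {poly rat}, p != 0 &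
  root (map_poly ratr p) x.

(** The rationals are the extension generated by the empty list; each further
    element is algebraic over the field generated by the previous ones. *)
Lemma number_field_adjoin_seq s :
  (forall x, x \in s -> algebraic_over_rat x) ->
  number_field (adjoin [set x | x \in s]).
Proof.
elim: s => [_|x s IH alg].
  exists (rat^o : fieldExtType rat), (ratr : {rmorphism rat -> C}).
  apply/seteqP; split.
    by apply: adjoin_min; [apply: range_subfield|move=> y].
  move=> _ [q _ <-]; set K := adjoin _.
  have [K1 KB KD] : subfield K by apply: adjoin_subfield.
  have KN y : K y -> K (- y).
    by move=> Ky; rewrite -sub0r; apply: (KB) => //; rewrite -(subrr 1); apply: KB.
  have Kn m : K m%:R.
    elim: m => [|m IHm]; first by rewrite mulr0n -(subrr 1); apply: KB.
    by rewrite -[m.+1]addn1 natrD -[X in _ + X]opprK; apply: (KB) => //; apply: KN.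
  rewrite /= /ratr; apply: KD; last by rewrite -[denq q]gez0_abs // -pmulrn; apply: Kn.
  by case: (numq q) => m; rewrite ?NegzE ?mulrNz -pmulrn; [|apply: KN]; apply: Kn.
have [L [iota E]] : number_field (adjoin [set y | y \in s]).
  by apply: IH => y ys; apply: alg; rewrite inE ys orbT.
have [p p0 px] := alg x (mem_head _ _).
have -> : [set y | y \in x :: s] = [set y | y \in s] `|` [set x].
  apply/seteqP; split=> y /=; rewrite inE.
    by case/predU1P => [->|]; [right|left].
  by case=> [->|->]; rewrite ?eqxx ?orbT.
rewrite -adjoinU E; apply: (@number_field_adjoin _ _ _ (map_poly (in_alg L) p)).
  by rewrite map_poly_eq0.
rewrite -map_poly_comp (eq_map_poly (g := ratr)) //.
exact: (fmorph_eq_rat (iota \o in_alg L)).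
Qed.

Lemma quadratic_tower_number_field F K :
  number_field F -> quadratic_tower F K -> number_field K.
Proof.
move=> nF; elim=> // {}K x _ [L [iota ->]] [y _ xy].
apply: (@number_field_adjoin _ _ _ ('X^2 - y%:P)).
  by rewrite -size_poly_eq0 size_XnsubC.
by rewrite rmorphB /= map_polyXn map_polyC /= rootE !hornerE xy subrr.
Qed.

(** Every square lies in the bottom field, so the elements of the list can be
    adjoined in any order, each step being quadratic. *)
Lemma quadratic_tower_seq F s :
  subfield F -> (forall x, x \in s -> F (x ^+ 2)) ->
  quadratic_tower F (adjoin (F `|` [set x | x \in s])).
Proof.
move=> sF; elim: s => [_|x s IH sq].
  rewrite (_ : _ `|` _ = F); first by rewrite adjoin_id //; constructor.
  by apply/seteqP; split=> [y [//|//]|y]; left.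
have -> : adjoin (F `|` [set y | y \in x :: s]) =
   adjoin (adjoin (F `|` [set y | y \in s]) `|` [set x]).
  rewrite adjoinU; congr adjoin; apply/seteqP; split=> y /=; rewrite inE.
    case=> [|/predU1P[->|]]; [by do 2 left|by right|by left; right].
  by case=> [[|->]|->]; [left|right; rewrite orbT|right; rewrite eqxx].
constructor; last by apply: sub_adjoin; left; apply: sq; rewrite mem_head.
by apply: IH => y ys; apply: sq; rewrite inE ys orbT.
Qed.

End FieldClosure.

(** * The field of square roots *)

Section SqrtField.
Local Open Scope classical_set_scope.
Variables (C : numClosedFieldType) (I : finType) (d : I -> nat).
Variables (D : forall l : I, 'rV[C]_(d l)) (N : nat).

Lemma sqrt_fieldP : [/\ subfield (sqrt_field D N),
    forall l, sqrt_field D N (sqrtC (d l)%:R), sqrt_field D N (sqrtC N%:R)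
  & forall l i, sqrt_field D N (sqrtC (D l 0 i))].
Proof.
split; first exact: adjoin_subfield.
- by move=> l; apply: sub_adjoin; left; left; exists l.
- by apply: sub_adjoin; left; right.
- by move=> l i; apply: sub_adjoin; right; exists l, i.
Qed.

Lemma eigenvalue_field_number_field :
  (forall l i, algebraic_over_rat (D l 0 i)) ->
  number_field (eigenvalue_field D).
Proof.
move=> alg; pose s := [seq D (tag u) 0 (tagged u) | u : {l : I & 'I_(d l)}].
rewrite /eigenvalue_field (_ : [set x | _] = [set x | x \in s]).
  apply: number_field_adjoin_seq => x /mapP[u _ ->]; apply: alg.
apply/seteqP; split=> x /=.
  by case=> l [i ->]; apply/mapP; exists (Tagged (fun l => 'I_(d l)) i); rewrite ?mem_enum.
by case/mapP => u _ ->; exists (tag u), (tagged u).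
Qed.

Lemma sqrt_field_tower : quadratic_tower (eigenvalue_field D) (sqrt_field D N).
Proof.
(* [eigenvalue_field D] is contained in [sqrt_field D N] because an eigenvalue
   is the square of its square root. *)
pose s := sqrtC N%:R :: [seq sqrtC (d l)%:R | l : I] ++
          [seq sqrtC (D (tag u) 0 (tagged u)) | u : {l : I & 'I_(d l)}].
have sF : subfield (eigenvalue_field D) by apply: adjoin_subfield.
have [F1 FB FD] := sF.
have F0 : eigenvalue_field D 0 by rewrite -(subrr 1); apply: FB.
have Fn n : eigenvalue_field D n%:R.
  elim: n => // n IH; rewrite -[n.+1]addn1 natrD -[X in _ + X]opprK; apply: (FB) => //.
  by rewrite -sub0r; apply: FB.
have -> : sqrt_field D N = adjoin (eigenvalue_field D `|` [set x | x \in s]).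
  have [sK Kd KN KD] := sqrt_fieldP.
  apply/seteqP; split; apply: adjoin_min => //; try exact: adjoin_subfield.
    move=> x xS; apply: sub_adjoin; right; rewrite /= /s in_cons mem_cat.
    case: xS => [[[l ->]|->]|[l [i ->]]]; rewrite ?eqxx //; apply/orP; right.
      by apply/orP; left; apply: map_f; rewrite mem_enum.
    by apply/orP; right; apply/mapP; exists (Tagged (fun l => 'I_(d l)) i); rewrite ?mem_enum.
  move=> x [].
    move: x; apply: (adjoin_min sK) => _ [l [i ->]]; rewrite -[D l 0 i]sqrtCK expr2.
    by apply: (subfieldM sK); apply: KD.
  rewrite /= /s in_cons mem_cat => /predU1P[-> //|/orP[]/mapP[u _ ->]] //.
apply: quadratic_tower_seq => // x.
rewrite /s in_cons mem_cat => /predU1P[->|/orP[]/mapP[u _ ->]]; rewrite sqrtCK //.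
by apply: sub_adjoin; exists (tag u), (tagged u).
Qed.

End SqrtField.

(** * Tableaux, tabloids and the dominance order *)

Section Tableaux.
Variable n : nat.
Import fintype finset.
Implicit Types (lam mu : intpart n) (T : tabloid n) (t : {ffun 'I_n -> 'I_n * 'I_n}).

Definition part_row lam (i : 'I_n) : nat := tnth (val lam) i.

Lemma part_row_anti lam (i j : 'I_n) : (i <= j)%N -> (part_row lam j <= part_row lam i)%N.
Proof.
move=> ij; have /andP[so _] := valP lam.
have rE (k : 'I_n) : part_row lam k = nth 0 (map val (val lam)) k.
  by rewrite (nth_map ord0) ?size_tuple // /part_row (tnth_nth ord0).
rewrite !rE; apply: (@sorted_leq_nth _ geq _ _ 0 _ so) => //.
- by move=> a b c /= ab bc; apply: leq_trans bc ab.
- by move=> a /=; apply: leqnn.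
- by rewrite inE size_map size_tuple.
- by rewrite inE size_map size_tuple.
Qed.

Lemma sum_part_row lam : (\sum_i part_row lam i)%N = n.
Proof.
have /andP[_ /eqP] := valP lam; apply: etrans.
by rewrite sumnE big_map big_tuple.
Qed.

Lemma part_row_inj lam mu : (forall i, part_row lam i = part_row mu i) -> lam = mu.
Proof. by move=> H; apply/val_inj/eq_from_tnth => i; apply: val_inj; apply: H. Qed.

Definition cells lam : {set 'I_n * 'I_n} := [set c : 'I_n * 'I_n | (c.2 < part_row lam c.1)%N].

Lemma card_cells_row lam i : #|[set c in cells lam | c.1 == i]| = part_row lam i.
Proof.
have le : (part_row lam i <= n)%N by rewrite -ltnS; apply: ltn_ord.
have -> : [set c in cells lam | c.1 == i] =
   [set (i, widen_ord le j) | j : 'I_(part_row lam i)].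
  apply/setP=> -[a b]; rewrite !inE /=; apply/andP/imsetP.
    by case=> ltb /eqP ai; subst a; exists (Ordinal ltb) => //; congr (_, _); apply: val_inj.
  by case=> j _ [-> ->] /=; rewrite eqxx ltn_ord.
rewrite card_imset ?card_ord // => j k /(congr1 (fun c : 'I_n * 'I_n => val c.2)) /= jk.
exact: val_inj.
Qed.

Lemma card_cells lam : #|cells lam| = n.
Proof.
rewrite -[RHS](sum_part_row lam) -sum1_card (partition_big fst xpredT) //=.
apply: eq_bigr => i _; rewrite -card_cells_row -sum1_card.
by apply: eq_bigl => c; rewrite inE.
Qed.

Lemma tableau_inj lam t : is_tableau lam t -> injective t.
Proof. by case/andP => /injectiveP. Qed.

Lemma tableau_cell lam t x : is_tableau lam t -> t x \in cells lam.
Proof. by case/andP => _ /forallP/(_ x); rewrite inE. Qed.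

Lemma tableau_onto lam t c : is_tableau lam t -> c \in cells lam -> {x | t x = c}.
Proof.
move=> tt cc; apply: sig_eqW; suff E : t @: 'I_n = cells lam.
  by move: cc; rewrite -E => /imsetP[x _ ->]; exists x.
apply/eqP; rewrite eqEcard card_cells (card_imset _ (tableau_inj tt)) card_ord leqnn andbT.
by apply/subsetP=> _ /imsetP[x _ ->]; apply: tableau_cell tt.
Qed.

Lemma exists_tableau lam : exists t, is_tableau lam t.
Proof.
exists [ffun x => enum_val (cast_ord (esym (card_cells lam)) x)].
apply/andP; split.
  by apply/injectiveP => x y; rewrite !ffunE => /enum_val_inj/cast_ord_inj.
apply/forallP=> x; rewrite ffunE.
by have := enum_valP (cast_ord (esym (card_cells lam)) x); rewrite inE.
Qed.

Definition has_content lam T := forall i, #|[set x | T x == i]| = part_row lam i.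

Lemma tableau_content lam t : is_tableau lam t -> has_content lam (tabloid_of t).
Proof.
move=> tt i; rewrite -card_cells_row -(card_imset _ (tableau_inj tt)).
apply: eq_card => c; rewrite inE; apply/imsetP/andP.
  by case=> x; rewrite inE ffunE => ti ->; rewrite (tableau_cell x tt).
by case=> /(tableau_onto tt)[x <-] ti; exists x; rewrite // inE ffunE.
Qed.

(** Dominance compares the partial sums [lam_0 + ... + lam_(k-1)]. *)
Definition rows_below lam k := (\sum_(i < n | (i < k)%N) part_row lam i)%N.

Lemma content_below lam T k : has_content lam T ->
  #|[set x | (T x < k)%N]| = rows_below lam k.
Proof.
move=> hT; rewrite -sum1_card (partition_big T (fun i : 'I_n => (i < k)%N)) /=; last first.
  by move=> x; rewrite inE.
apply: eq_bigr => i ik; rewrite -hT -sum1_card; apply: eq_bigl => x.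
by rewrite !inE; case: eqP => [->|_]; rewrite ?ik ?andbF.
Qed.

Definition dominates lam mu := forall k, (rows_below mu k <= rows_below lam k)%N.

Lemma dominates_anti lam mu : dominates lam mu -> dominates mu lam -> lam = mu.
Proof.
move=> H1 H2; have E k : rows_below lam k = rows_below mu k.
  by apply/eqP; rewrite eqn_leq H1 H2.
apply: part_row_inj => i; have S nu : rows_below nu i.+1 = (part_row nu i + rows_below nu i)%N.
  rewrite /rows_below (bigD1 i) //=; congr addn; apply: eq_bigl => j.
  by rewrite ltnS [RHS]ltn_neqAle andbC.
by have := E i.+1; rewrite !S E => /addIn.
Qed.

Definition column_injective t T :=
  forall x y, T x = T y -> (t x).2 = (t y).2 -> x = y.

(** The entries of the [j]-th column of [t] lying in the first [k] rows of [T]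
    number at most [k], and at most the length of the column.  In [t] the column
    is filled from the top, so it reaches the smaller of these two bounds. *)
Lemma column_count lam t T j k : is_tableau lam t -> column_injective t T ->
  (#|[set x | ((t x).2 == j) && (T x < k)]| <=
   #|[set x | ((t x).2 == j) && ((t x).1 < k)]|)%N.
Proof.
move=> tt cT; set A := finset _; set B := finset _.
have [AB|] := boolP (A \subset B); first exact: subset_leq_card.
case/subsetPn => x; rewrite !inE => /andP[/eqP xj _]; rewrite xj eqxx /= -leqNgt => kx.
have kn : (k <= n)%N by apply: leq_trans kx (ltnW (ltn_ord _)).
apply: (@leq_trans k).
  rewrite -(card_in_imset (f := T) (D := mem A)); last first.
    move=> y z; rewrite !inE => /andP[/eqP yj _] /andP[/eqP zj _] Tyz.
    by apply: cT; rewrite ?yj ?zj.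
  apply: (@leq_trans #|[set widen_ord kn i | i : 'I_k]|).
    apply: subset_leq_card; apply/subsetP => _ /imsetP[y yA ->].
    move: yA; rewrite !inE => /andP[_ ltk]; apply/imsetP.
    by exists (Ordinal ltk) => //; apply: val_inj.
  by rewrite (leq_trans (leq_imset_card _ _)) // card_ord.
have cell (i : 'I_k) : (widen_ord kn i, j) \in cells lam.
  rewrite inE /=; have := tableau_cell x tt; rewrite inE xj => /leq_trans; apply.
  by apply: part_row_anti; rewrite /= ltnW // (leq_trans (ltn_ord i)).
pose f (i : 'I_k) := sval (tableau_onto tt (cell i)).
have fE i : t (f i) = (widen_ord kn i, j) := svalP (tableau_onto tt (cell i)).
have finj : injective f.
  move=> i i' /(congr1 t); rewrite !fE => /(congr1 (fun c : 'I_n * 'I_n => val c.1)) /= ii.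
  exact: val_inj.
rewrite -[k in (k <= _)%N]card_ord -(card_imset _ finj); apply: subset_leq_card.
by apply/subsetP => _ /imsetP[i _ ->]; rewrite inE fE /= eqxx ltn_ord.
Qed.

Lemma card_by_column t (P : pred 'I_n) :
  #|[set x | P x]| = (\sum_j #|[set x | ((t x).2 == j) && P x]|)%N.
Proof.
rewrite -sum1_card (partition_big (fun x => (t x).2) xpredT) //=.
apply: eq_bigr => j _; rewrite -sum1_card; apply: eq_bigl => x.
by rewrite !inE andbC.
Qed.

(** Adding [column_count] over the columns compares the partial sums of the
    two shapes. *)
Lemma column_injective_dominates lam mu t T :
  is_tableau lam t -> has_content mu T -> column_injective t T -> dominates lam mu.
Proof.
move=> tt hT cT k; rewrite -(content_below k hT) -(content_below k (tableau_content tt)).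
rewrite !(card_by_column t); apply: leq_sum => j _.
rewrite (leq_trans (column_count j k tt cT)) //.
by apply: subset_leq_card; apply/subsetP=> x; rewrite !inE ffunE.
Qed.

(** When [T] also has shape [lam], the sums over the columns in [column_count]
    agree, hence so do the terms: each column of [t] meets the same rows in [T]
    as in [t], and [T] comes from [t] by permuting the columns. *)
Lemma column_injective_tabloid lam t T :
  is_tableau lam t -> has_content lam T -> column_injective t T ->
  exists2 s : 'S_n, s \in col_stab t & forall x, T x = (t (s x)).1.
Proof.
move=> tt hT cT.
have Ek j k : #|[set x | ((t x).2 == j) && (T x < k)%N]| =
              #|[set x | ((t x).2 == j) && ((t x).1 < k)%N]|.
  have /leqif_sum : forall j, xpredT j ->
    (#|[set x | ((t x).2 == j) && (T x < k)%N]| <=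
     #|[set x | ((t x).2 == j) && ((t x).1 < k)%N]| ?= iff
     (#|[set x | ((t x).2 == j) && (T x < k)%N]| ==
      #|[set x | ((t x).2 == j) && ((t x).1 < k)%N]|))%N.
    by move=> i _; split=> //; apply: column_count tt cT.
  rewrite -!card_by_column (content_below k hT) -(content_below k (tableau_content tt)).
  case=> _; rewrite (eq_card (B := [set x | ((t x).1 < k)%N])); last first.
    by move=> x; rewrite !inE ffunE.
  by rewrite eqxx => /esym/forallP/(_ j)/eqP.
(* The cell of [t] that lies in the row of [x] in [T] and in the column of
   [x] in [t]: by differences of the counts, this column of [t] has an entry in
   row [T x]. *)
have cell x : {y | t y = (T x, (t x).2)}.
  apply: sig_eqW.
  have S (f : 'I_n -> 'I_n) j k :
      #|[set x | ((t x).2 == j) && (f x < k.+1)%N]| =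
      (#|[set x | ((t x).2 == j) && (f x == k :> nat)]| +
       #|[set x | ((t x).2 == j) && (f x < k)%N]|)%N.
    rewrite -cardsUI [X in (_ + X)%N]eq_card0 ?addn0 => [|y]; last first.
      by rewrite !inE; case: (f y =P k :> nat) => [->|]; rewrite ?ltnn !andbF.
    by apply: eq_card => y; rewrite !inE -andb_orr ltnS leq_eqVlt.
  have := Ek (t x).2 (T x).+1; rewrite !S Ek => /addIn E.
  have : x \in [set x0 | ((t x0).2 == (t x).2) && (T x0 == T x :> nat)].
    by rewrite inE !eqxx.
  case: (set_0Vmem [set x0 | ((t x0).2 == (t x).2) && ((t x0).1 == T x :> nat)]) => [E0|[y]].
    by move: E; rewrite E0 cards0 => /eqP; rewrite cards_eq0 => /eqP ->; rewrite inE.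
  rewrite inE => /andP[/eqP y2 /eqP y1] _; exists y.
  by rewrite [t y]surjective_pairing y2; congr (_, _); apply: val_inj.
pose f x := sval (cell x); have fE x : t (f x) = (T x, (t x).2) := svalP (cell x).
have finj : injective f by move=> x y /(congr1 t); rewrite !fE => -[]; apply: cT.
exists (perm finj); last by move=> x; rewrite permE fE.
by rewrite inE; apply/forallP => x; rewrite permE fE.
Qed.

End Tableaux.

(** * Polytabloids and the column alternating property *)

Section Polytabloids.
Variable n : nat.
Import fintype finset.
Implicit Types (lam mu : intpart n) (T : tabloid n) (t : {ffun 'I_n -> 'I_n * 'I_n}).
Implicit Types (s u : 'S_n).

Lemma tabloid_actM T s u : tabloid_act (tabloid_act T s) u = tabloid_act T (s * u)%g.
Proof. by apply/ffunP=> x; rewrite !ffunE invMg permM. Qed.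

Lemma tabloid_act1 T : tabloid_act T 1%g = T.
Proof. by apply/ffunP=> x; rewrite ffunE invg1 perm1. Qed.

Lemma tabloid_act_eq T T' s : (tabloid_act T s^-1%g == T') = (T == tabloid_act T' s).
Proof.
apply/eqP/eqP => [<-|->]; rewrite tabloid_actM ?mulVg ?mulgV ?tabloid_act1 //.
Qed.

Lemma content_act lam T s : has_content lam T -> has_content lam (tabloid_act T s).
Proof.
move=> hT i; rewrite -hT -(card_imset [set x | T x == i] (@perm_inj _ s)).
apply: eq_card => x; rewrite !inE ffunE; apply/eqP/imsetP => [E|[y]].
  by exists (s^-1%g x); rewrite ?permKV // inE E.
by rewrite inE => /eqP <- ->; rewrite permK.
Qed.

Lemma col_stabP t s : reflect (forall x, (t (s x)).2 = (t x).2) (s \in col_stab t).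
Proof. by rewrite inE; apply: (iffP forallP) => H x; apply/eqP; rewrite H. Qed.

Lemma col_stabM t s u : u \in col_stab t -> (s * u)%g \in col_stab t = (s \in col_stab t).
Proof.
move=> /col_stabP ut; apply/col_stabP/col_stabP => H x; have := H x.
  by rewrite permM ut.
by rewrite permM ut.
Qed.

Lemma polytabloid_col t u T : u \in col_stab t ->
  polytabloid t (tabloid_act T u^-1%g) = (-1) ^+ odd_perm u * polytabloid t T.
Proof.
move=> ut; rewrite !ffunE mulr_sumr (reindex_inj (mulIg u^-1%g)) /=.
have ut' : u^-1%g \in col_stab t.
  by apply/col_stabP => x; rewrite -{2}[x](permKV u) (col_stabP _ _ ut).
apply: eq_big => [s|s _]; first by rewrite col_stabM.
rewrite odd_permM odd_permV signr_addb tabloid_act_eq tabloid_actM mulgKV.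
by rewrite mulrA [X in X * _]mulrC.
Qed.

(** A permutation that preserves the columns of [t] and fixes its tabloid also
    preserves the rows, so it is the identity. *)
Lemma polytabloid_self lam t : is_tableau lam t -> polytabloid t (tabloid_of t) = 1.
Proof.
move=> tt; rewrite ffunE (bigD1 1%g) /=; last by apply/col_stabP => x; rewrite perm1.
rewrite odd_perm1 tabloid_act1 eqxx mulr1 big1 ?addr0 // => s /andP[/col_stabP sc s1].
case: eqP => [E|_]; last by rewrite mulr0.
case/eqP: s1; apply/permP => x; rewrite perm1; apply: (tableau_inj tt).
move/ffunP/(_ (s x)): E; rewrite !ffunE permK => E.
by rewrite [LHS]surjective_pairing [RHS]surjective_pairing sc E.
Qed.

Lemma polytabloid_content lam t T :
  is_tableau lam t -> polytabloid t T != 0 -> has_content lam T.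
Proof.
move=> tt; apply: contra_neqP => nc; rewrite ffunE big1 // => s _.
case: eqP => [E|_]; last by rewrite mulr0.
by case: nc; rewrite E; apply/content_act/tableau_content.
Qed.

Lemma polytabloid_conj t s T :
  polytabloid [ffun x => t (s^-1%g x)] T = polytabloid t (tabloid_act T s^-1%g).
Proof.
rewrite !ffunE (reindex_inj (conjg_inj s)) /=; apply: eq_big => [u|u _].
  apply/col_stabP/col_stabP => H x.
    have := H (s x); rewrite !ffunE permK conjgE !permM.
    by rewrite permK permK.
  by rewrite !ffunE conjgE !permM permK H.
rewrite odd_permJ tabloid_act_eq tabloid_actM; congr (_ * (_ == _)%:R).
apply/ffunP => x; rewrite !ffunE conjgE !invMg !invgK; rewrite !permM !permK.
by [].
Qed.

Lemma tableau_conj lam t t' : is_tableau lam t -> is_tableau lam t' ->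
  exists s : 'S_n, t' = [ffun x => t (s^-1%g x)].
Proof.
move=> tt tt'; pose f x := sval (tableau_onto tt (tableau_cell x tt')).
have fE x : t (f x) = t' x := svalP (tableau_onto tt (tableau_cell x tt')).
have finj : injective f.
  by move=> x y /(congr1 t); rewrite !fE => /(tableau_inj tt').
by exists (perm finj)^-1%g; apply/ffunP=> x; rewrite !ffunE invgK permE fE.
Qed.

Variable C : numClosedFieldType.
Implicit Types w : tabloid n -> C.

Definition col_alternating t w := forall u T, u \in col_stab t ->
  w (tabloid_act T u^-1%g) = (-1) ^+ odd_perm u * w T.

(** If two entries share a row of [T] and a column of [t], their transposition
    fixes [T] and changes the sign of [w T]. *)
Lemma col_alternating_injective t w T :
  col_alternating t w -> w T != 0 -> column_injective t T.
Proof.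
move=> alt wT x y Txy txy; apply/eqP; apply: contraNT wT => xy.
have st : tperm x y \in col_stab t.
  by apply/col_stabP => z; case: tpermP => [->|->|//].
have := alt _ T st; rewrite (_ : tabloid_act T _ = T); last first.
  by apply/ffunP => z; rewrite ffunE invgK; case: tpermP => [->|->|//].
rewrite odd_tperm xy expr1 mulN1r => /eqP.
by rewrite -subr_eq0 opprK -mulr2n mulrn_eq0.
Qed.

Lemma col_alternating_polytabloid t : col_alternating t (fun T => ratr (polytabloid t T)).
Proof. by move=> u T ut; rewrite polytabloid_col // rmorphM rmorph_sign. Qed.

(** The tabloids of shape [lam] that are injective on the columns of [t] form
    one orbit of the column group, that of the tabloid of [t]; elsewhere an
    alternating function vanishes.  So its value at that tabloid determines it. *)
Lemma col_alternating_unique lam t w : is_tableau lam t -> col_alternating t w ->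
  (forall T, w T != 0 -> has_content lam T) ->
  forall T, w T = w (tabloid_of t) * ratr (polytabloid t T).
Proof.
move=> tt alt wc T.
have palt := @col_alternating_polytabloid t.
have [/asboolP [hT cT]|/asboolPn H] := boolP `[< has_content lam T /\ column_injective t T >].
  have [s st E] := column_injective_tabloid tt hT cT.
  have -> : T = tabloid_act (tabloid_of t) s^-1%g.
    by apply/ffunP => x; rewrite !ffunE invgK E.
  by rewrite alt // palt // (polytabloid_self tt) rmorph1 mulr1 mulrC.
have [w0|wT] := eqVneq (w T) 0; last first.
  by case: H; split; [apply: wc|apply: col_alternating_injective wT].
have [p0|pT] := eqVneq (ratr (polytabloid t T) : C) 0; first by rewrite w0 p0 mulr0.
case: H; split; last exact: (col_alternating_injective palt pT).
by apply: (polytabloid_content tt); rewrite fmorph_eq0 in pT.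
Qed.

End Polytabloids.

(** * Coordinates in a Specht module *)

Section SpechtForm.
Variables (n : nat) (C : numClosedFieldType) (lam : intpart n) (d : nat).
Variable rG : mx_representation rat [set: 'S_n]%G d.
Variable e : d.-tuple (tabloid_space n).
Hypothesis eB : basis_of (specht lam) e.
Hypothesis eG : forall (s : 'S_n) (i : 'I_d),
  space_act e`_i s = \sum_(j < d) rG s i j *: e`_j.

Let rC (s : 'S_n) : 'M[C]_d := map_mx ratr (rG s).

(** The vector with complex coordinates [u], as a function on tabloids.  Working
    with these functions avoids extending the scalars of the Specht module. *)
Definition realize (u : 'rV[C]_d) (T : tabloid n) : C :=
  \sum_j u 0 j * ratr ((e`_j : tabloid_space n) T).

Lemma realizeB u v T : realize (u - v) T = realize u T - realize v T.
Proof. by rewrite -sumrB; apply: eq_bigr => j _; rewrite !mxE mulrBl. Qed.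

Lemma realizeZ a u T : realize (a *: u) T = a * realize u T.
Proof. by rewrite mulr_sumr; apply: eq_bigr => j _; rewrite !mxE mulrA. Qed.

(** The basis, free over the rationals, stays free over [C], since the rank of
    a matrix does not change under field extension. *)
Lemma realize_inj u v : (forall T, realize u T = realize v T) -> u = v.
Proof.
pose E : 'M[rat]_(d, _) :=
  \matrix_(j < d, k < #|{: tabloid n}|) (e`_j : tabloid_space n) (enum_val k).
have fE : row_free E.
  apply: inj_row_free => v0 v0E; apply/rowP => i; rewrite mxE.
  have /freeP := basis_free eB; apply; apply/ffunP => T.
  rewrite sum_ffunE ffunE; move/rowP/(_ (enum_rank T)): v0E; rewrite !mxE => E0.
  by rewrite -[RHS]E0; apply: eq_bigr => j _; rewrite !mxE enum_rankK ffunE.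
have fE' : row_free (map_mx (ratr : rat -> C) E) by rewrite row_free_map.
move=> H; apply/eqP; rewrite -subr_eq0; apply/eqP.
apply: (row_free_inj fE'); rewrite mul0mx; apply/rowP => k.
have := H (enum_val k) => /eqP; rewrite -subr_eq0 -realizeB => /eqP E0.
by rewrite !mxE -[RHS]E0; apply: eq_bigr => j _; rewrite !mxE.
Qed.

Lemma realize_act u s T : realize (u *m rC s) T = realize u (tabloid_act T s^-1%g).
Proof.
transitivity (\sum_i \sum_j u 0 i * ratr (rG s i j * (e`_j : tabloid_space n) T)).
  rewrite exchange_big /=; apply: eq_bigr => j _; rewrite mxE mulr_suml.
  by apply: eq_bigr => i _; rewrite !mxE rmorphM -mulrA.
apply: eq_bigr => i _; rewrite -mulr_sumr -rmorph_sum; congr (_ * ratr _).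
have /ffunP/(_ T) := eG s i; rewrite ffunE => ->.
by rewrite sum_ffunE; apply: eq_bigr => j _; rewrite ffunE.
Qed.

Definition coordv (v : tabloid_space n) : 'rV[C]_d := \row_j ratr (coord e j v).

Lemma realize_coordv v T : v \in specht lam -> realize (coordv v) T = ratr (v T).
Proof.
move=> vS; rewrite {2}(coord_basis eB vS) sum_ffunE rmorph_sum.
by apply: eq_bigr => j _; rewrite mxE ffunE rmorphM.
Qed.

Lemma polytabloid_specht t : is_tableau lam t -> polytabloid t \in specht lam.
Proof. by move=> tt; apply/memv_span/map_f; rewrite mem_enum. Qed.

Lemma specht_content v T : v \in specht lam -> v T != 0 -> has_content lam T.
Proof.
move=> vS; apply: contra_neqP => nc.
rewrite (coord_span (X := in_tuple _) vS) sum_ffunE big1 // => i _; rewrite ffunE.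
have /mapP[t] := mem_nth 0 (ltn_ord i); rewrite mem_enum => tt ->.
have [->|p0] := eqVneq (polytabloid t T) 0; first by rewrite scaler0.
by case: nc; apply: polytabloid_content p0.
Qed.

Lemma realize_content u T : realize u T != 0 -> has_content lam T.
Proof.
apply: contra_neqP => nc; rewrite /realize big1 // => j _.
have [->|p0] := eqVneq ((e`_j : tabloid_space n) T) 0; first by rewrite rmorph0 mulr0.
by case: nc; apply: specht_content p0; apply: (basis_mem eB); rewrite mem_nth ?size_tuple.
Qed.

(** The polytabloids span the module, so they detect the matrices acting on
    it. *)
Lemma polytabloid_generate m (B : 'M[C]_(d, m)) :
  (forall t, is_tableau lam t -> coordv (polytabloid t) *m B = 0) -> B = 0.
Proof.
move=> H; have S v : v \in specht lam -> coordv v *m B = 0.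
  move=> vS; rewrite (coord_span (X := in_tuple _) vS); set X := in_tuple _.
  have -> : coordv (\sum_(i < _) coord X i v *: X`_i) =
            \sum_(i < _) ratr (coord X i v) *: coordv X`_i.
    apply/rowP=> j; rewrite !mxE linear_sum rmorph_sum summxE.
    by apply: eq_bigr => i _; rewrite !mxE linearZ rmorphM.
  rewrite mulmx_suml big1 // => i _; rewrite -scalemxAl.
  have /mapP[t] := mem_nth 0 (ltn_ord i); rewrite mem_enum => tt ->.
  by rewrite H ?scaler0.
apply/row_matrixP=> i; rewrite row0 rowE -[RHS](S e`_i); last first.
  by apply: (basis_mem eB); rewrite mem_nth ?size_tuple.
congr (_ *m _); apply/rowP => j; rewrite !mxE coord_free ?(basis_free eB) //.
by rewrite rmorph_nat eqxx eq_sym.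
Qed.

Lemma coordv_conj t (s : 'S_n) : is_tableau lam t -> is_tableau lam [ffun x => t (s^-1%g x)] ->
  coordv (polytabloid [ffun x => t (s^-1%g x)]) = coordv (polytabloid t) *m rC s.
Proof.
move=> tt tt'; apply: realize_inj => T; rewrite realize_act.
by rewrite !realize_coordv ?polytabloid_specht // polytabloid_conj.
Qed.

Lemma coordv_col t u : is_tableau lam t -> u \in col_stab t ->
  coordv (polytabloid t) *m rC u = (-1) ^+ odd_perm u *: coordv (polytabloid t).
Proof.
move=> tt ut; apply: realize_inj => T; rewrite realize_act realizeZ.
by rewrite !realize_coordv ?polytabloid_specht // polytabloid_col // rmorphM rmorph_sign.
Qed.

Lemma specht_dim_gt0 : (0 < d)%N.
Proof.
rewrite lt0n; apply/eqP => d0; have [t tt] := exists_tableau lam.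
have := realize_coordv (tabloid_of t) (polytabloid_specht tt).
rewrite (polytabloid_self tt) rmorph1 /realize big1 => [/eqP|j].
  by rewrite eq_sym oner_eq0.
by have := ltn_ord j; rewrite {2}d0.
Qed.

End SpechtForm.

(** * Intertwiners between Specht modules *)

(** Matrices act on row vectors, so [A] maps the module of [r] to that of
    [r']. *)
Definition intertwiner (gT : finGroupType) (F : fieldType) d d' (r : gT -> 'M[F]_d)
  (r' : gT -> 'M[F]_d') (A : 'M[F]_(d, d')) := forall g, r g *m A = A *m r' g.

Section Intertwiners.
Variables (n : nat) (C : numClosedFieldType).
Local Notation extend r := (fun g => map_mx (ratr : rat -> C) (r g)).

(** [A] commutes with the column group of [t], which acts on the polytabloid by
    the sign. *)
Lemma intertwiner_alternating lam d (rG : mx_representation rat [set: 'S_n]%G d)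
    mu d' (rG' : mx_representation rat [set: 'S_n]%G d')
    (e : d.-tuple (tabloid_space n)) (e' : d'.-tuple (tabloid_space n)) A t :
  basis_of (specht lam) e ->
  (forall (s : 'S_n) (i : 'I_d), space_act e`_i s = \sum_(j < d) rG s i j *: e`_j) ->
  basis_of (specht mu) e' ->
  (forall (s : 'S_n) (i : 'I_d'), space_act e'`_i s = \sum_(j < d') rG' s i j *: e'`_j) ->
  intertwiner (extend rG) (extend rG') A ->
  is_tableau lam t ->
  col_alternating t (realize e' (coordv C e (polytabloid t) *m A)).
Proof.
move=> eB eG eB' eG' AG tt u T ut.
by rewrite -(realize_act eG') -mulmxA -AG mulmxA (coordv_col C eB eG) // -scalemxAl realizeZ.
Qed.

Lemma specht_intertwiner_dominates lam d (rG : mx_representation rat [set: 'S_n]%G d)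
    mu d' (rG' : mx_representation rat [set: 'S_n]%G d') A :
  specht_form lam rG -> specht_form mu rG' ->
  intertwiner (extend rG) (extend rG') A ->
  A != 0 -> dominates lam mu.
Proof.
move=> [e [eB eG]] [e' [eB' eG']] AG; apply: contra_neqP => ndom.
apply: (polytabloid_generate eB) => t tt; apply: (realize_inj eB') => T.
have -> : realize e' 0 T = 0 :> C by rewrite /realize big1 // => j _; rewrite mxE mul0r.
apply/eqP; apply: contra_notT ndom => wT.
apply: (column_injective_dominates tt (realize_content eB' wT)).
exact: (col_alternating_injective (intertwiner_alternating eB eG eB' eG' AG tt) wT).
Qed.

(** [A] multiplies one polytabloid by a scalar, by [col_alternating_unique].
    All polytabloids are translates of this one, so the scalar is the same. *)
Lemma specht_intertwiner_scalar lam d (rG : mx_representation rat [set: 'S_n]%G d) A :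
  specht_form lam rG ->
  intertwiner (extend rG) (extend rG) A ->
  exists a, A = a%:M.
Proof.
move=> [e [eB eG]] AG; have [t tt] := exists_tableau lam.
set c := coordv C e (polytabloid t).
exists (realize e (c *m A) (tabloid_of t)); set a := realize _ _ _.
have cA : c *m A = a *: c.
  apply: (realize_inj eB) => T; rewrite realizeZ (realize_coordv C eB) ?polytabloid_specht //.
  apply: (col_alternating_unique tt); last by move=> T'; apply: (realize_content eB).
  exact: (intertwiner_alternating eB eG eB eG AG tt).
apply/eqP; rewrite -subr_eq0; apply/eqP.
apply: (polytabloid_generate eB) => t' tt'; have [s E] := tableau_conj tt tt'.
rewrite E (coordv_conj C eB eG) ?E -?E // -/c mulmxBr -mulmxA AG mulmxA cA.
by rewrite -scalemxAl mul_mx_scalar subrr.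
Qed.

End Intertwiners.

(** * Making a rational representation unitary *)

Section Unitarize.
Variables (gT : finGroupType) (d : nat) (C : numClosedFieldType).
Variable rG : mx_representation rat [set: gT]%G d.
Local Notation P := (average_form rG).
Local Notation PC := (map_mx (ratr : rat -> C) P).
Local Notation rC g := (map_mx (ratr : rat -> C) (rG g)).

Lemma conj_map_ratr m p (A : 'M[rat]_(m, p)) :
  (map_mx (ratr : rat -> C) A)^t* = map_mx ratr A^T.
Proof.
by apply/matrixP=> i j; rewrite !mxE (fmorph_rat (@Num.conj C)).
Qed.

Lemma average_form_sym : P^T = P.
Proof.
rewrite /average_form linearZ linear_sum /=; congr (_ *: _).
by apply: eq_bigr => g _; rewrite trmx_mul trmxK.
Qed.

Lemma average_form_inv h : rG h *m P *m (rG h)^T = P.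
Proof.
rewrite -scalemxAr -scalemxAl; congr (_ *: _).
rewrite mulmx_sumr mulmx_suml [RHS](reindex_inj (mulgI h)) /=.
by apply: eq_bigr => g _; rewrite repr_mxM ?inE // trmx_mul !mulmxA.
Qed.

Lemma sqnorm_ge0 p (v : 'rV[C]_p) : 0 <= (v *m v^t*) 0 0.
Proof. by rewrite mxE sumr_ge0 // => j _; rewrite !mxE mul_conjC_ge0. Qed.

Lemma sqnorm_gt0 p (v : 'rV[C]_p) : v != 0 -> 0 < (v *m v^t*) 0 0.
Proof.
move=> v0; rewrite lt_neqAle sqnorm_ge0 andbT eq_sym; apply: contra v0.
rewrite mxE psumr_eq0 => [/allP H|j _]; last by rewrite !mxE mul_conjC_ge0.
apply/eqP/rowP=> j; have := H j (mem_index_enum _).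
by rewrite !mxE mul_conjC_eq0 => /eqP.
Qed.

(** The value is a mean of the squared norms of the vectors [v rho(g)], and the
    term of the identity is positive. *)
Lemma average_form_pos_complex (v : 'rV[C]_d) : v != 0 -> 0 < (v *m PC *m v^t*) 0 0.
Proof.
move=> v0; have -> : v *m PC *m v^t* =
    #|gT|%:R^-1 *: \sum_g (v *m rC g) *m (v *m rC g)^t*.
  rewrite /average_form map_mxZ fmorphV /= rmorph_nat -scalemxAr -scalemxAl.
  congr (_ *: _); rewrite raddf_sum /= mulmx_sumr mulmx_suml.
  apply: eq_bigr => g _.
  by rewrite map_mxM trmx_mul map_mxM conj_map_ratr !mulmxA.
rewrite mxE mulr_gt0 // ?invr_gt0 ?ltr0n; first by apply/card_gt0P; exists 1%g.
rewrite summxE (bigD1 1%g) //= repr_mx1 map_mx1 mulmx1.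
by apply: ltr_wpDr (sqnorm_gt0 v0); apply: sumr_ge0 => g _; apply: sqnorm_ge0.
Qed.

Lemma average_form_pos (v : 'rV[rat]_d) : v != 0 -> 0 < (v *m P *m v^T) 0 0.
Proof.
move=> v0; rewrite -(ltr0q C).
have := @average_form_pos_complex (map_mx ratr v).
rewrite map_mx_eq0 conj_map_ratr -!map_mxM mxE; exact.
Qed.

Variables (M : 'M[C]_d) (D : 'rV[C]_d).
Hypotheses (M_unit : M \in unitmx) (P_diag : PC = M *m diag_mx D *m invmx M).

Lemma diagonalized_eigenrow i :
  row i (invmx M) != 0 /\ row i (invmx M) *m PC = D 0 i *: row i (invmx M).
Proof.
split.
  apply/eqP => /(congr1 (fun v => (v *m M) 0 i)).
  by rewrite -row_mul mulVmx // mul0mx !mxE eqxx => /eqP; rewrite oner_eq0.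
rewrite P_diag -row_mul !mulmxA mulVmx // mul1mx row_mul.
apply/rowP => j; rewrite !mxE (bigD1 i) //= big1 ?addr0 => [|k ki]; rewrite !mxE.
  by rewrite eqxx mulr1n.
by rewrite eq_sym (negPf ki) mul0r.
Qed.

(** Evaluating the form at an eigenvector [r] gives [D_i |r|^2]. *)
Lemma eigenvalue_pos i : 0 < D 0 i.
Proof.
have [r0 rP] := diagonalized_eigenrow i.
have := average_form_pos_complex r0; rewrite rP -scalemxAl mxE.
by rewrite pmulr_lgt0 // sqnorm_gt0.
Qed.

Lemma eigenvalue_algebraic i : algebraic_over_rat (D 0 i).
Proof.
exists (char_poly P); first by rewrite monic_neq0 ?char_poly_monic.
rewrite map_char_poly /= -eigenvalue_root_char; apply/eigenvalueP.
by have [r0 rP] := diagonalized_eigenrow i; exists (row i (invmx M)).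
Qed.

Local Notation S := (diag_mx (\row_i sqrtC (D 0 i))).
Local Notation Q := (diag_sqrt M D).

Lemma diag_sqrt_sqr : Q *m Q = PC.
Proof.
rewrite /diag_sqrt P_diag !mulmxA mulmxKV //; congr (_ *m _).
rewrite -mulmxA mulmx_diag; congr (_ *m diag_mx _); apply/rowP => i.
by rewrite !mxE -expr2 sqrtCK.
Qed.

Lemma diag_sqrt_unit : Q \in unitmx.
Proof.
rewrite /diag_sqrt !unitmx_mul M_unit unitmx_inv M_unit andbT /= unitmxE det_diag.
rewrite unitfE; apply/prodf_neq0 => i _; rewrite mxE sqrtC_eq0 gt_eqF //.
exact: eigenvalue_pos.
Qed.

(** The columns of [M] need not be orthonormal.  But [P] is Hermitian, so its
    eigenspaces are orthogonal: the Gram matrix [M^t* M] commutes with [D],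
    hence with the square root of [D], which makes [Q] Hermitian. *)
Lemma diag_sqrt_hermitian : Q^t* = Q.
Proof.
have conjM m p q (A : 'M[C]_(m, p)) (B : 'M[C]_(p, q)) : (A *m B)^t* = B^t* *m A^t*.
  by rewrite trmx_mul map_mxM.
have MV : (invmx M)^t* *m M^t* = 1%:M by rewrite -conjM mulmxV // trmx1 map_mx1.
have diagC (v : 'rV[C]_d) : (forall i, 0 <= v 0 i) -> (diag_mx v)^t* = diag_mx v.
  move=> v0; rewrite tr_diag_mx map_diag_mx; congr diag_mx; apply/rowP=> i.
  by rewrite mxE; apply: geC0_conj.
have DC := diagC D (fun i => ltW (eigenvalue_pos i)).
pose N := M^t* *m M.
have ND : N *m diag_mx D = diag_mx D *m N.
  have PM : PC *m M = M *m diag_mx D by rewrite P_diag mulmxKV.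
  have PH : PC^t* = PC by rewrite conj_map_ratr average_form_sym.
  by rewrite /N -mulmxA -PM mulmxA -{1}PH -conjM PM conjM DC mulmxA.
have NS : N *m S = S *m N.
  clearbody N; apply/matrixP=> i j; have /matrixP/(_ i j) := ND.
  rewrite !mul_mx_diag !mul_diag_mx !mxE.
  have [Dij E|Dij E] := eqVneq (D 0 i) (D 0 j); first by rewrite Dij mulrC.
  have /eqP : N i j * (D 0 j - D 0 i) = 0.
    by rewrite mulrBr E [X in X - _]mulrC subrr.
  rewrite mulf_eq0 subr_eq0 eq_sym [D 0 j == _]eq_sym (negPf Dij) orbF => /eqP <-.
  by rewrite mul0r mulr0.
rewrite /diag_sqrt !conjM diagC; last first.
  by move=> i; rewrite mxE sqrtC_ge0 ltW // eigenvalue_pos.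
apply: (canRL (mulmxK _)) => //.
rewrite -[RHS]mul1mx -MV -!mulmxA; congr (_ *m _).
by rewrite [RHS]mulmxA -/N NS.
Qed.

Local Notation tau := (conj_repr rG Q).

Lemma diag_sqrt_intertwines g : Q *m tau g = rC g *m Q.
Proof. by rewrite /conj_repr !mulmxA mulmxV ?diag_sqrt_unit // mul1mx. Qed.

Lemma conj_repr_mx_repr : mx_repr [set: gT] tau.
Proof.
move: Q diag_sqrt_unit => q qU.
split=> [|g h _ _]; rewrite /conj_repr.
  by rewrite repr_mx1 map_mx1 mulmx1 mulVmx.
by rewrite repr_mxM ?inE // map_mxM !mulmxA mulmxK.
Qed.

(** [Q^-1 rho(g) Q Q rho(g)^T Q^-1 = Q^-1 P Q^-1] by invariance of [P]. *)
Lemma conj_repr_unitary g : tau g \is unitarymx.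
Proof.
move: Q diag_sqrt_unit diag_sqrt_hermitian diag_sqrt_sqr => q qU qH qS.
have qVH : (invmx q)^t* = invmx q by rewrite trmx_inv map_invmx qH.
apply/unitarymxP; rewrite /conj_repr !trmx_mul !map_mxM qH qVH conj_map_ratr.
rewrite !mulmxA -[_ *m q *m q]mulmxA qS -2!(mulmxA (invmx q)).
rewrite -!map_mxM average_form_inv -qS.
by rewrite mulmxA mulVmx // mul1mx mulmxV.
Qed.

Lemma exists_interpolation (F : fieldType) (s : seq F) (f : F -> F) :
  exists p : {poly F}, forall x, x \in s -> p.[x] = f x.
Proof.
elim: s => [|a s [p IH]]; first by exists 0.
have [as_|as_] := boolP (a \in s).
  by exists p => x; rewrite inE => /predU1P[->|]; apply: IH.
pose q := \prod_(b <- s) ('X - b%:P).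
have qa : q.[a] != 0 by rewrite -[_ == 0]/(root q a) root_prod_XsubC.
exists (p + ((f a - p.[a]) / q.[a]) *: q) => x; rewrite inE => /predU1P[->|xs].
  by rewrite !hornerE divfK // addrC subrK.
have /eqP qx : root q x by rewrite root_prod_XsubC.
by rewrite !hornerE qx mulr0 addr0 IH.
Qed.

(** The case distinction on the size is there because only square matrices of
    positive size form a ring in which polynomials can be evaluated. *)
Lemma diagonalized_horner (F L : fieldType) (iota : {rmorphism L -> F}) k
    (V : 'M[F]_k) (a b : 'rV[F]_k) (A : 'M[L]_k) (p : {poly L}) :
  V \in unitmx -> map_mx iota A = V *m diag_mx a *m invmx V ->
  (forall i, (map_poly iota p).[a 0 i] = b 0 i) ->
  exists B : 'M[L]_k, V *m diag_mx b *m invmx V = map_mx iota B.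
Proof.
case: k V a b A => [|k] V a b A VU AE pE; first by exists 0; apply/matrixP => -[].
exists (horner_mx A p); rewrite map_horner_mx AE horner_mx_uconj // horner_mx_diag.
congr (_ *m diag_mx _ *m _).
by apply/rowP => i; rewrite mxE pE.
Qed.

(** [Q] is a polynomial in the rational matrix [P], whose coefficients lie in the
    subfield since it contains the eigenvalues and their square roots. *)
Lemma conj_repr_field (L : fieldType) (iota : {rmorphism L -> C}) :
  (forall i, range iota (sqrtC (D 0 i))) -> forall g i j, range iota (tau g i j).
Proof.
move=> sL g i j.
have rL m (A : 'M[rat]_m) : map_mx (ratr : rat -> C) A = map_mx iota (map_mx ratr A).
  by apply/matrixP=> a b; rewrite !mxE fmorph_rat.
suff [A ->] : exists A : 'M[L]_d, tau g = map_mx iota A.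
  by exists (A i j); rewrite ?mxE.
suff [B QB] : exists B : 'M[L]_d, Q = map_mx iota B.
  exists (invmx B *m map_mx ratr (rG g) *m B).
  by rewrite /conj_repr rL QB -map_invmx -!map_mxM.
have {}sL i0 : {x | iota x = sqrtC (D 0 i0)}.
  by apply: cid; have [x _ <-] := sL i0; exists x.
pose S0 i0 := sval (sL i0).
have SE i0 : iota (S0 i0) = sqrtC (D 0 i0) := svalP (sL i0).
have DE i0 : iota (S0 i0 ^+ 2) = D 0 i0 by rewrite rmorphXn /= SE sqrtCK.
(* The square root on the eigenvalues, computed in [L]: any index [i0] giving
   the eigenvalue [x] will do, as the root depends only on [x]. *)
pose f x := odflt 0 (omap S0 [pick i0 | S0 i0 ^+ 2 == x]).
have [p pE] := exists_interpolation [seq S0 i0 ^+ 2 | i0 : 'I_d] f.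
apply: (diagonalized_horner (A := map_mx ratr P) (p := p) M_unit (a := D)).
  by rewrite -rL.
move=> i0; rewrite mxE -DE horner_map pE; last by apply/mapP; exists i0; rewrite ?mem_enum.
rewrite /f /=.
case: pickP => [i1 /eqP /= E|/(_ i0)]; last by rewrite eqxx.
by rewrite SE DE -[D 0 i0]DE -E DE.
Qed.

End Unitarize.

(** * Schur orthogonality *)

Section Orthogonality.
Variables (gT : finGroupType) (C : numClosedFieldType).

Section TwoReps.
Variables (d d' : nat) (tau : gT -> 'M[C]_d) (tau' : gT -> 'M[C]_d').
Hypotheses (tauR : mx_repr [set: gT] tau) (tau'R : mx_repr [set: gT] tau').
Hypotheses (tauU : forall g, tau g \is unitarymx) (tau'U : forall g, tau' g \is unitarymx).

(** Averaging any matrix over the group yields an intertwiner; on elementary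
    matrices the entries are the inner products of matrix coefficients. *)
Definition twirl (X : 'M[C]_(d, d')) := \sum_g tau g *m X *m (tau' g)^t*.

Lemma twirl_intertwiner X : intertwiner tau tau' (twirl X).
Proof.
move=> h; rewrite mulmx_sumr mulmx_suml [RHS](reindex_inj (mulgI h)) /=.
apply: eq_bigr => g _; rewrite tauR.2 ?inE // tau'R.2 ?inE // trmx_mul map_mxM !mulmxA.
by rewrite -[RHS]mulmxA -(invmx_unitary (tau'U h)) mulVmx ?unitarymx_unit // mulmx1.
Qed.

Lemma twirl_coef i j k l :
  twirl (delta_mx j l) i k = \sum_g tau g i j * (tau' g k l)^*.
Proof.
rewrite summxE; apply: eq_bigr => g _; rewrite mxE (bigD1 l) //= big1 ?addr0.
  rewrite mxE (bigD1 j) //= big1 ?addr0 => [|a aj]; first by rewrite !mxE !eqxx mulr1.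
  by rewrite !mxE (negPf aj) mulr0.
move=> b bl; rewrite mxE big1 ?mul0r // => a _.
by rewrite !mxE (negPf bl) andbF mulr0.
Qed.

(** For unitary representations the adjoint of [tau g] is its inverse, so taking
    adjoints reverses the direction of an intertwiner. *)
Lemma intertwiner_adjoint A : intertwiner tau tau' A -> intertwiner tau' tau (A^t*).
Proof.
move=> AG g.
have tV : (tau g)^t* *m tau g = 1%:M.
  by rewrite -(invmx_unitary (tauU g)) mulVmx ?unitarymx_unit.
rewrite -[LHS]mulmx1 -tV mulmxA -[X in X *m _]mulmxA -map_mxM -trmx_mul AG.
by rewrite trmx_mul map_mxM mulmxA (unitarymxP (tau'U g)) mul1mx.
Qed.

Lemma orthogonal_coefs i j k l :
  (forall A, intertwiner tau tau' A -> A = 0) ->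
  \sum_g tau g i j * (tau' g k l)^* = 0.
Proof.
move=> H; transitivity (twirl (delta_mx j l) i k); first by rewrite twirl_coef.
by rewrite (H _ (twirl_intertwiner _)) mxE.
Qed.

End TwoReps.

(** The scalar equal to the averaged matrix is found by taking traces. *)
Lemma orthonormal_coefs d (tau : gT -> 'M[C]_d) (i j k l : 'I_d) :
  mx_repr [set: gT] tau -> (forall g, tau g \is unitarymx) ->
  (forall A, intertwiner tau tau A -> exists a, A = a%:M) ->
  \sum_g tau g i j * (tau g k l)^* = #|gT|%:R / d%:R * ((i == k) && (j == l))%:R.
Proof.
move=> tauR tauU sc.
transitivity (twirl tau tau (delta_mx j l) i k); first by rewrite twirl_coef.
have [a E] := sc _ (twirl_intertwiner tauR tauR tauU (delta_mx j l)).
have d0 : d%:R != 0 :> C.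
  by rewrite pnatr_eq0 -lt0n; case: d i {tau j k l tauR tauU sc E} => // -[].
have : \tr (twirl tau tau (delta_mx j l)) = #|gT|%:R * (j == l)%:R.
  rewrite raddf_sum /= (eq_bigr (fun=> (j == l)%:R)) ?sumr_const ?mulr_natl // => g _.
  rewrite mxtrace_mulC mulmxA -invmx_unitary // mulVmx ?unitarymx_unit // mul1mx.
  rewrite /mxtrace (bigD1 j) //= big1 ?addr0 => [|b bj]; rewrite !mxE ?eqxx //.
  by rewrite (negPf bj).
rewrite E mxtrace_scalar -[LHS]mulr_natr => trE; have aE := canRL (mulfK d0) trE.
by rewrite mxE aE mulrAC; case: (i == k); rewrite ?mulr1n ?mulr0n ?mulr0.
Qed.

Variables (I : finType) (d : I -> nat) (tau : forall l, gT -> 'M[C]_(d l)).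

Lemma fourier_mx_unitary :
  (forall l, mx_repr [set: gT] (tau l)) ->
  (forall l g, tau l g \is unitarymx) ->
  (forall l A, intertwiner (tau l) (tau l) A -> exists a, A = a%:M) ->
  (forall l m A, l != m -> intertwiner (tau l) (tau m) A -> A = 0) ->
  fourier_mx tau \is unitarymx.
Proof.
move=> tauR tauU sc dj; apply/unitarymxP/matrixP => r r'; rewrite !mxE.
rewrite -(inj_eq enum_val_inj).
case Er: (enum_val r) => [l [i j]]; case Er': (enum_val r') => [m [k h]] /=.
pose a := fourier_scale C gT d.
have aC x : (a x)^* = a x by apply: geC0_conj; rewrite sqrtC_ge0 divr_ge0.
transitivity (a l * a m * \sum_g tau l g i j * (tau m g k h)^*).
  rewrite mulr_sumr (reindex _ (onW_bij _ (@enum_val_bij gT))) /=.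
  by apply: eq_bigr => c _; rewrite !mxE Er Er' /= rmorphM /= aC mulrACA.
have [lm|lm] := eqVneq l m; last first.
  rewrite orthogonal_coefs ?mulr0 //; last by move=> A; apply: dj.
  by case: eqP => // /(congr1 tag) /= E; rewrite E eqxx in lm.
subst m; rewrite orthonormal_coefs //; last exact: sc.
rewrite -/(Tagged (fun l => ('I_(d l) * 'I_(d l))%type) (i, j)).
rewrite -/(Tagged (fun l => ('I_(d l) * 'I_(d l))%type) (k, h)) eq_Tagged xpair_eqE.
rewrite mulrA -expr2 sqrtCK mulrA divfK; last first.
  by rewrite pnatr_eq0 -lt0n; apply/card_gt0P; exists 1%g.
rewrite divff ?mul1r // pnatr_eq0 -lt0n.
exact: leq_ltn_trans (ltn_ord i).
Qed.

End Orthogonality.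

(** * Conjugacy classes of the symmetric group *)

Section CycleType.
Variable n : nat.
Import fintype finset.
Implicit Types (s t : 'S_n).

(** The cycles of [s], including the fixed points, by decreasing length. *)
Definition cycles s : seq {set 'I_n} :=
  sort (relpre (fun A : {set 'I_n} => #|A|) geq) (enum (porbits s)).

(** Beyond the last cycle the value is the empty set, of cardinal 0: this is the
    padding by zeros of a partition. *)
Definition nth_cycle s i := nth finset.set0 (cycles s) i.

Lemma mem_cycles s (A : {set 'I_n}) : (A \in cycles s) = (A \in porbits s).
Proof. by rewrite mem_sort mem_enum. Qed.

Lemma cycles_uniq s : uniq (cycles s).
Proof. by rewrite sort_uniq enum_uniq. Qed.

Lemma nth_cycle_porbit s x : nth_cycle s (index (porbit s x) (cycles s)) = porbit s x.
Proof. by rewrite /nth_cycle nth_index // mem_cycles imset_f. Qed.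

Lemma nth_cycle_gt0 s i : (0 < #|nth_cycle s i|)%N = (i < size (cycles s))%N.
Proof.
have [lt|le] := ltnP i (size (cycles s)); last by rewrite /nth_cycle nth_default ?cards0.
have := mem_nth finset.set0 lt; rewrite mem_cycles => /imsetP[x _ E].
by rewrite /nth_cycle E lt0n card_porbit_neq0.
Qed.

Lemma size_cycles s : (size (cycles s) <= n)%N.
Proof.
rewrite size_sort -cardE (leq_trans (leq_imset_card _ _)) //.
by rewrite -[X in (_ <= X)%N]card_ord max_card.
Qed.

Lemma cycle_lengths_padded s : mkseq (fun i => #|nth_cycle s i|) n =
  [seq #|A| | A : {set 'I_n} <- cycles s] ++ nseq (n - size (cycles s)) 0.
Proof.
apply: (@eq_from_nth _ 0) => [|i].
  by rewrite size_mkseq size_cat size_map size_nseq subnKC // size_cycles.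
rewrite size_mkseq => lt_in; rewrite nth_mkseq // nth_cat size_map.
case: ltnP => [lt|le]; first by rewrite (nth_map finset.set0).
by rewrite nth_nseq if_same /nth_cycle nth_default ?cards0.
Qed.

Lemma sorted_cycle_lengths s : sorted geq (mkseq (fun i => #|nth_cycle s i|) n).
Proof.
apply/(sortedP 0) => i; rewrite size_mkseq => lt; rewrite !nth_mkseq //; last exact: ltnW.
have [lt2|le] := ltnP i.+1 (size (cycles s)); last by rewrite /nth_cycle (nth_default _ le) cards0.
have so : sorted (relpre (fun A : {set 'I_n} => #|A|) geq) (cycles s).
  by apply: sort_sorted => A B /=; apply: leq_total.
by move/(sortedP finset.set0)/(_ i lt2): so.
Qed.

Lemma sum_cycle_lengths s : sumn (mkseq (fun i => #|nth_cycle s i|) n) = n.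
Proof.
rewrite cycle_lengths_padded sumn_cat sumn_nseq mul0n addn0 sumnE big_map.
rewrite (perm_big (enum (porbits s))) ?perm_sort //= big_enum /=.
apply: etrans (card_ord n); rewrite -sum1_card.
rewrite (partition_big (porbit s) (mem (porbits s))) /= => [|x _]; last exact: imset_f.
apply: eq_bigr => _ /imsetP[x _ ->]; rewrite -sum1_card.
by apply: eq_bigl => y; rewrite eq_porbit_mem.
Qed.

Lemma nth_cycle_card_lt s i : (#|nth_cycle s i| < n.+1)%N.
Proof. by rewrite ltnS -[X in (_ <= X)%N]card_ord max_card. Qed.

Lemma cycle_type_subproof s :
  is_intpart [tuple Ordinal (nth_cycle_card_lt s i) | i < n].
Proof.
have E : map val [tuple Ordinal (nth_cycle_card_lt s i) | i < n] =
         mkseq (fun i => #|nth_cycle s i|) n.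
  by rewrite -map_comp /mkseq -val_enum_ord -map_comp; apply: eq_map.
by rewrite /is_intpart E sorted_cycle_lengths sum_cycle_lengths eqxx.
Qed.

Definition cycle_type s : intpart n :=
  exist (@is_intpart n) _ (cycle_type_subproof s).

Lemma cycle_type_card s t i : cycle_type s = cycle_type t ->
  #|nth_cycle s i| = #|nth_cycle t i|.
Proof.
move=> E; have [lt|le] := ltnP i n.
  have := congr1 (fun lam => val (tnth (val lam) (Ordinal lt))) E.
  by rewrite !tnth_mktuple.
by rewrite /nth_cycle !nth_default // (leq_trans (size_cycles _)).
Qed.

Lemma iter_eq_mod s x k k' :
  ((s ^+ k)%g x == (s ^+ k')%g x) = (k == k' %[mod #|porbit s x|])%N.
Proof.
set m := #|_|; have m0 : (0 < m)%N by rewrite lt0n card_porbit_neq0.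
have red a : (s ^+ a)%g x = nth x (traject s x m) (a %% m)%N.
  rewrite nth_traject ?ltn_pmod // {1}(divn_eq a m) addnC permX iterD; congr iter.
  by elim: (a %/ m)%N => // b IH; rewrite mulSn iterD IH iter_porbit.
by rewrite !red nth_uniq ?size_traject ?ltn_pmod ?uniq_traject_porbit.
Qed.

(** Choose a base point in each cycle of [s] and of [t], and send [s^k y] to
    [t^k z] when [y] and [z] are the base points of cycles of equal rank.  As
    these cycles have the same length, the map is well defined and injective. *)
Lemma cycle_type_conj s t : cycle_type s = cycle_type t -> exists u, t = (s ^ u)%g.
Proof.
move=> st; have cE i := cycle_type_card i st.
pose rep r i := [pick x in nth_cycle r i].
have repP r i : (i < size (cycles r))%N ->
    exists2 x, rep r i = Some x & porbit r x = nth_cycle r i.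
  rewrite -nth_cycle_gt0 /rep => i0; case: pickP => [x xr|H]; last first.
    by case/card_gt0P: i0 => x; rewrite H.
  exists x => //; apply/eqP; move: i0 xr; rewrite nth_cycle_gt0 => i0.
  have := mem_nth finset.set0 i0; rewrite mem_cycles => /imsetP[y _ E].
  by rewrite /nth_cycle E eq_porbit_mem.
pose idx x := index (porbit s x) (cycles s).
have idxs x : (idx x < size (cycles s))%N by rewrite index_mem mem_cycles imset_f.
have idxt x : (idx x < size (cycles t))%N by rewrite -nth_cycle_gt0 -cE nth_cycle_gt0.
have coord x : {yz : 'I_n * 'I_n & {k | [/\ rep s (idx x) = Some yz.1,
    rep t (idx x) = Some yz.2, x = (s ^+ k)%g yz.1 & 
    (porbit s yz.1 = nth_cycle s (idx x)) /\ (porbit t yz.2 = nth_cycle t (idx x))]}}.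
  have /cid2[y Ey yP] := repP s _ (idxs x); have /cid2[z Ez zP] := repP t _ (idxt x).
  exists (y, z); apply: cid => /=.
  have /porbitP[k xk] : x \in porbit s y by rewrite yP nth_cycle_porbit porbit_id.
  by exists k.
pose h x := let: existT yz (exist k _) := coord x in (t ^+ k)%g yz.2.
have hP x : exists y z k, [/\ rep s (idx x) = Some y, rep t (idx x) = Some z,
    x = (s ^+ k)%g y, h x = (t ^+ k)%g z &
    porbit s y = nth_cycle s (idx x) /\ porbit t z = nth_cycle t (idx x)].
  rewrite /h; case: (coord x) => [[y z] [k [? ? ? ?]]].
  by exists y, z, k.
have hs x : h (s x) = t (h x).
  have [y [z [k [Ey Ez xk -> [yP zP]]]]] := hP x.
  have [y' [z' [k' [Ey' Ez' sxk -> _]]]] := hP (s x).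
  have idxE : idx (s x) = idx x by rewrite /idx -[s x]/((s ^+ 1)%g x) porbit_perm.
  move: Ey' Ez'; rewrite idxE Ey Ez => -[yy] [zz]; subst y' z'.
  rewrite -permM -expgSr; apply/eqP; rewrite iter_eq_mod zP -cE -yP -iter_eq_mod.
  by rewrite -sxk xk -permM -expgSr.
have hinj : injective h.
  move=> x x'; have [y [z [k [Ey Ez xk -> [yP zP]]]]] := hP x.
  have [y' [z' [k' [Ey' Ez' xk' -> [yP' zP']]]]] := hP x'.
  move=> E; have idxE : idx x = idx x'.
    apply/eqP; rewrite -(nth_uniq finset.set0 (idxt x) (idxt x') (cycles_uniq t)).
    by rewrite -/(nth_cycle t _) -zP -/(nth_cycle t _) -zP' -(porbit_perm t k) E porbit_perm.
  move: Ey' Ez'; rewrite -idxE Ey Ez => -[yy] [zz]; subst y' z'.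
  apply/eqP; rewrite xk xk' iter_eq_mod yP cE -zP -iter_eq_mod; exact/eqP.
exists (perm hinj); rewrite conjgE.
have -> : (s * perm hinj = perm hinj * t)%g by apply/permP => x; rewrite !permM !permE hs.
by rewrite mulKg.
Qed.

Lemma card_classes_Sn : (#|classes [set: 'S_n]| <= #|{: intpart n}|)%N.
Proof.
rewrite -(card_in_imset (f := fun A => cycle_type (repr A))) ?max_card //.
move=> _ _ /imsetP[s _ ->] /imsetP[t _ ->] /cycle_type_conj[u].
have [a _ ->] := repr_class [set: 'S_n] s; have [b _ ->] := repr_class [set: 'S_n] t.
move=> E; rewrite -[RHS](classGidl t (y := b)) ?inE // E.
by rewrite !classGidl ?inE.
Qed.

End CycleType.

(** * The Specht modules are all the irreducible representations *)

(** The projection onto a submodule along an invariant complement commutes with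
    the action; being a scalar, it is 0 or 1. *)
Lemma scalar_centralizer_irr (F : fieldType) (gT : finGroupType) (G : {group gT})
    n (rG : mx_representation F G n) :
  (0 < n)%N -> ([pchar F]^'.-group G)%g ->
  (forall A, centgmx rG A -> exists a, A = a%:M) -> mx_irreducible rG.
Proof.
move=> n0 F'G sc; apply/mx_irrP; split=> // U modU U0.
have [W modW defV /mxdirect_addsP dx] := mx_Maschke_pchar rG F'G modU (submx1 U).
have [a aE] : exists a, proj_mx U W = a%:M.
  apply: sc; rewrite -row_full_dom_hom -sub1mx -defV.
  exact: proj_mx_hom.
have UaE := proj_mx_id dx (submx_refl U).
have a0 : a != 0.
  by apply: contraNneq U0 => a0; rewrite -UaE aE a0 mul_mx_scalar scale0r.
rewrite -sub1mx -(eqmx_scale 1%:M a0) scalemx1 -aE -[proj_mx U W]mul1mx.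
exact: proj_mx_sub.
Qed.

Section Completeness.
Variables (n : nat) (C : numClosedFieldType) (d : intpart n -> nat).
Variable rho : forall lam : intpart n, mx_representation rat [set: 'S_n]%G (d lam).
Hypothesis rho_specht : forall lam, specht_form lam (rho lam).

(** There are as many irreducible representations as classes, hence at most as
    many as partitions, so the injection of the Specht modules into the
    irreducible representations is onto. *)
Lemma sum_specht_dim_sqr : (\sum_lam d lam ^ 2)%N = #|{: 'S_n}|.
Proof.
pose G := [set: 'S_n]%G.
have C'G : ([pchar C]^'.-group G)%g.
  by apply/pgroupP => p _ _; rewrite inE /= pchar_num.
have splitG : group_splitting_field C G by apply: group_closure_closed_field.
pose sG : irrType C G := DecSocleType (regular_repr C G).
pose rC lam := map_repr (ratr : {rmorphism rat -> C}) (rho lam).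
have irr lam : mx_irreducible (rC lam).
  apply: scalar_centralizer_irr => // [|A /centgmxP cA].
    by have [e [eB _]] := rho_specht lam; apply: (specht_dim_gt0 C eB).
  by apply: (specht_intertwiner_scalar (rho_specht lam)) => s; rewrite cA ?inE.
pose ic lam : sG := irr_comp sG (rC lam).
have sim lam : mx_rsim (rC lam) (irr_repr (ic lam)) by apply: rsim_irr_comp_pchar.
have dE lam : d lam = irr_degree (ic lam) by have := mxrank_rsim (sim lam).
have dom lam mu : mx_rsim (rC lam) (rC mu) -> dominates lam mu.
  case=> B _ freeB homB.
  apply: (specht_intertwiner_dominates (rho_specht lam) (rho_specht mu) (A := B)).
    by move=> s; rewrite homB ?inE.
  apply: contraTneq freeB => ->; rewrite /row_free mxrank0 eq_sym -lt0n.
  by have [e [eB _]] := rho_specht lam; apply: (specht_dim_gt0 C eB).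
have icinj : injective ic.
  move=> lam mu E; have S : mx_rsim (rC lam) (rC mu).
    by apply: mx_rsim_trans (sim lam) _; rewrite E; apply: mx_rsim_sym.
  by apply: dominates_anti; apply: dom => //; apply: mx_rsim_sym.
have icbij : bijective ic.
  apply: inj_card_bij => //; rewrite card_irr_pchar //.
  exact: card_classes_Sn.
have := sum_irr_degree_pchar sG C'G splitG.
rewrite (reindex ic) /= => [|]; last exact: onW_bij.
by rewrite cardsT => <-; apply: eq_bigr => lam _; rewrite dE.
Qed.

End Completeness.

(** * The discrete Fourier transform *)

Lemma card_fourier_index (I : finType) (d : I -> nat) :
  #|{: fourier_index d}| = (\sum_l d l ^ 2)%N.
Proof.
rewrite card_tagged sumnE big_map big_enum /=.
by apply: eq_bigr => l _; rewrite card_prod card_ord.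
Qed.

Lemma intertwiner_conj (gT : finGroupType) (F : fieldType) d d'
    (r t : gT -> 'M[F]_d) (r' t' : gT -> 'M[F]_d') Q Q' A :
  (forall g, Q *m t g = r g *m Q) -> (forall g, Q' *m t' g = r' g *m Q') ->
  Q' \in unitmx -> intertwiner t t' A -> intertwiner r r' (Q *m A *m invmx Q').
Proof.
move=> Qt Qt' Q'U At g.
have E : t' g *m invmx Q' = invmx Q' *m r' g.
  by apply: (canRL (mulKmx Q'U)); rewrite mulmxA Qt' mulmxK.
by rewrite !mulmxA -Qt -(mulmxA Q) At -!mulmxA E.
Qed.

Theorem mainTheorem2 (R : realType) (n : nat) (n_gt0 : (0 < n)%N)
    (d : intpart n -> nat)
    (rho : forall lam : intpart n, mx_representation rat [set: 'S_n]%G (d lam))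
    (rho_specht : forall lam : intpart n, specht_form lam (rho lam))
    (M : forall lam : intpart n, 'M[R[i]]_(d lam))
    (D : forall lam : intpart n, 'rV[R[i]]_(d lam))
    (M_unit : forall lam : intpart n, M lam \in unitmx)
    (P_diag : forall lam : intpart n,
       map_mx ratr (average_form (rho lam)) =
       M lam *m diag_mx (D lam) *m invmx (M lam)) :
  let P (lam : intpart n) := average_form (rho lam) in
  let Q (lam : intpart n) := diag_sqrt (M lam) (D lam) in
  let tau (lam : intpart n) (g : 'S_n) := conj_repr (rho lam) (Q lam) g in
  let K := sqrt_field D #|'S_n| in
  [/\ forall lam : intpart n,
        (P lam)^T = P lam /\
        forall v : 'rV[rat]_(d lam), v != 0 -> 0 < (v *m P lam *m v^T) 0 0,
      subfield K /\ number_field K,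
      quadratic_tower (eigenvalue_field D) K,
      forall lam : intpart n,
        [/\ mx_repr [set: 'S_n] (tau lam),
            forall (g : 'S_n) (i j : 'I_(d lam)), K (tau lam g i j)
          & forall g : 'S_n, tau lam g \is unitarymx]
    & #|{: fourier_index d}| = #|{: 'S_n}| /\
      fourier_mx tau \is unitarymx].
Proof.
move=> P Q tau K.
have [sK _ _ KD] := sqrt_fieldP D #|'S_n|.
have tower := sqrt_field_tower D #|'S_n|.
have nK : number_field K.
  apply: quadratic_tower_number_field tower; apply: eigenvalue_field_number_field.
  by move=> lam i; apply: eigenvalue_algebraic (M_unit lam) (P_diag lam) i.
have tauR lam : mx_repr [set: 'S_n] (tau lam).
  exact: conj_repr_mx_repr (M_unit lam) (P_diag lam).
have tauU lam g : tau lam g \is unitarymx.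
  exact: conj_repr_unitary (M_unit lam) (P_diag lam) g.
have QU lam : Q lam \in unitmx by apply: diag_sqrt_unit (M_unit lam) (P_diag lam).
have conj_intertwiner lam mu A : intertwiner (tau lam) (tau mu) A ->
    intertwiner (fun g => map_mx (ratr : rat -> R[i]) (rho lam g))
      (fun g => map_mx ratr (rho mu g)) (Q lam *m A *m invmx (Q mu)).
  have S nu := diag_sqrt_intertwines (M_unit nu) (P_diag nu).
  exact: (intertwiner_conj (S lam) (S mu) (QU mu)).
split=> //.
- by move=> lam; split; [apply: average_form_sym|apply: (average_form_pos R[i])].
- move=> lam; split=> // g i j.
  case: nK => L [iota KE]; rewrite KE.
  by apply: (conj_repr_field (M_unit lam) (P_diag lam)) => k; rewrite -KE; apply: KD.
split; first by rewrite card_fourier_index; apply: (sum_specht_dim_sqr R[i] rho_specht).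
have dom lam mu A : A != 0 -> intertwiner (tau lam) (tau mu) A -> dominates lam mu.
  move=> A0 /conj_intertwiner AG.
  apply: (specht_intertwiner_dominates (rho_specht lam) (rho_specht mu) AG).
  apply: contraNneq A0 => E; rewrite -[A](mulKmx (QU lam)) -[_ *m A](mulmxKV (QU mu)) E.
  by rewrite mul0mx mulmx0.
apply: fourier_mx_unitary => //.
  move=> lam A AG.
  have [a E] := specht_intertwiner_scalar (rho_specht lam) (conj_intertwiner _ _ _ AG).
  exists a; rewrite -[A](mulKmx (QU lam)) -[_ *m A](mulmxKV (QU lam)) E.
  by rewrite mul_scalar_mx -scalemxAr mulVmx // scalemx1.
move=> lam mu A lm AG; apply/eqP; apply: contraNT lm => A0; apply/eqP.
apply: dominates_anti; first exact: dom AG.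
apply: (dom _ _ (A^t*)); last exact: intertwiner_adjoint.
by rewrite map_mx_eq0 trmx_eq0.
Qed.
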